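(* For all integers $m, n \geqslant 2$, \[ r(I_m, L_n) \leqslant 2^{19n} \cdot \frac{m^{n-1}}{(\log_2 m)^{n-2}}. \]
   Context: An oriented graph is a finite directed graph with no loops in which each pair of distinct vertices is joined by at most one arc. $I_m$ denotes an independent set of $m$ vertices and $L_n$ the transitive tournament on $n$ vertices. $r(I_m, L_n)$ is the least natural number $k$ such that every oriented graph on $k$ vertices contains either an independent set of size $m$ or a set of $n$ vertices inducing a transitive tournament. *)

(* Defs.v *)
From mathcomp Require Import all_boot all_order all_algebra.
From mathcomp Require Import boolp reals exp.

Set Implicit Arguments.
Unset Strict Implicit.
Unset Printing Implicit Defensive.

Import Order.TTheory GRing.Theory Num.Theory.

Definition oriented_graph (T : finType) (arc : rel T) : Prop :=
  irreflexive arc /\ (forall x y : T, x != y -> ~~ (arc x y && arc y x)).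

Definition independent_set (T : finType) (arc : rel T) (S : {set T}) : Prop :=
  forall x y : T, x \in S -> y \in S -> ~~ arc x y.

(* Looplessness and "at most one arc" are part of [oriented_graph]. *)
Definition transitive_tournament (T : finType) (arc : rel T) (S : {set T}) :
    Prop :=
  (forall x y : T, x \in S -> y \in S -> x != y -> arc x y \/ arc y x) /\
  (forall x y z : T, x \in S -> y \in S -> z \in S ->
     arc x y -> arc y z -> arc x z).

Definition ramsey_prop (m n k : nat) : Prop :=
  forall (T : finType) (arc : rel T), #|T| = k -> oriented_graph arc ->
    (exists S : {set T}, #|S| = m /\ independent_set arc S) \/
    (exists S : {set T}, #|S| = n /\ transitive_tournament arc S).

Lemma ramsey_bound (m n : nat) : exists N : nat,
  forall (T : finType) (arc : rel T) (A : {set T}), oriented_graph arc ->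
    N <= #|A| ->
    (exists S : {set T}, [/\ S \subset A, #|S| = m & independent_set arc S]) \/
    (exists S : {set T},
       [/\ S \subset A, #|S| = n & transitive_tournament arc S]).
Proof.
elim: m n => [|m IHm] n.
  exists 0 => T arc A _ _; left; exists set0.
  by split; [exact: sub0set|rewrite cards0|move=> x y; rewrite inE].
elim: n => [|n [N2 IHn]].
  exists 0 => T arc A _ _; right; exists set0.
  by split; [exact: sub0set|rewrite cards0|split=> x y; rewrite inE].
have [N1 {}IHm] := IHm n.+1.
exists (N1 + N2 + N2).+1 => T arc A og hA.
have [irr asym] := og.
have [v vA] : exists v, v \in A by apply/card_gt0P; apply: leq_ltn_trans hA.
have asy x y : arc x y -> arc y x = false.
  move=> xy; have [exy|/asym] := eqVneq x y; last by rewrite xy => /negbTE.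
  by rewrite exy irr in xy.
pose P := [set y in A | arc v y]; pose M := [set y in A | arc y v].
pose O := [set y in A | [&& y != v, ~~ arc v y & ~~ arc y v]].
have sub (Q : pred T) (S : {set T}) : ~~ Q v ->
    S \subset [set y in A | Q y] ->
    [/\ v |: S \subset A, #|v |: S| = #|S|.+1 & forall y, y \in S -> Q y].
  move=> Qv /subsetP SQ; split.
  - apply/subsetP=> y; rewrite !inE => /predU1P[->//|/SQ].
    by rewrite inE => /andP[].
  - rewrite cardsU1; case: (boolP (v \in S)) => // /SQ.
    by rewrite inE (negbTE Qv) andbF.
  - by move=> y /SQ; rewrite inE => /andP[].
have sub' (Q : pred T) (S : {set T}) : S \subset [set y in A | Q y] ->
    S \subset A.
  by move=> SQ; apply: subset_trans SQ _; apply/subsetP=> y; rewrite inE;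
    case/andP.
have cA : #|A| <= (#|O| + #|P| + #|M|).+1.
  have -> : A = v |: (O :|: P :|: M).
    apply/setP=> y; rewrite !inE.
    by case: (eqVneq y v) => [->|_]; [|case: (y \in A); case: (arc v y);
      case: (arc y v)].
  rewrite cardsU1; apply: (@leq_trans #|O :|: P :|: M|.+1).
    by case: (_ \in _); rewrite ?add0n.
  rewrite ltnS; apply: (leq_trans (leq_card_setU _ _)).
  by rewrite leq_add2r leq_card_setU.
have [hO|hO] := leqP N1 #|O|.
  have [[S [SO cS iS]]|[S [SO cS tS]]] := IHm T arc O og hO; last first.
    by right; exists S; split=> //; exact: sub' SO.
  left; exists (v |: S).
  have [|SA cvS QS] := sub _ _ _ SO; first by rewrite eqxx.
  split; rewrite ?cvS ?cS // => x y; rewrite !inE.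
  case/predU1P=> [->|xS] /predU1P[->|yS].
  - by rewrite irr.
  - by have /and3P[] := QS _ yS.
  - by have /and3P[] := QS _ xS.
  - exact: iS.
have [hP|hP] := leqP N2 #|P|.
  have [[S [SP cS iS]]|[S [SP cS tS]]] := IHn T arc P og hP.
    by left; exists S; split=> //; exact: sub' SP.
  right; exists (v |: S).
  have [|SA cvS QS] := sub _ _ _ SP; first by rewrite irr.
  split; rewrite ?cvS ?cS //; case: tS => tS1 tS2; split.
    move=> x y; rewrite !inE; case/predU1P=> [->|xS] /predU1P[->|yS].
    - by rewrite eqxx.
    - by left; exact: QS.
    - by right; exact: QS.
    - exact: tS1.
  move=> x y z; rewrite !inE.
  case/predU1P=> [->|xS] /predU1P[->|yS] /predU1P[->|zS] //.
  - by move=> /asy ->.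
  - by move=> _ _; exact: QS.
  - by rewrite (asy _ _ (QS _ xS)).
  - by rewrite (asy _ _ (QS _ yS)).
  - exact: tS2.
have hM : N2 <= #|M|.
  rewrite leqNgt; apply/negP=> hM; move: (leq_trans hA cA).
  rewrite ltnS leqNgt => /negP; apply.
  rewrite -addnS; apply: leq_add hM.
  exact: leq_add (ltnW hO) (ltnW hP).
have [[S [SM cS iS]]|[S [SM cS tS]]] := IHn T arc M og hM.
  by left; exists S; split=> //; exact: sub' SM.
right; exists (v |: S).
have [|SA cvS QS] := sub (fun y => arc y v) _ _ SM; first by rewrite irr.
split; rewrite ?cvS ?cS //; case: tS => tS1 tS2; split.
  move=> x y; rewrite !inE; case/predU1P=> [->|xS] /predU1P[->|yS].
  - by rewrite eqxx.
  - by right; exact: QS.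
  - by left; exact: QS.
  - exact: tS1.
move=> x y z; rewrite !inE.
case/predU1P=> [->|xS] /predU1P[->|yS] /predU1P[->|zS] //.
- by move=> /asy ->.
- by rewrite (asy _ _ (QS _ yS)).
- by rewrite (asy _ _ (QS _ zS)).
- by move=> _ _; exact: QS.
- exact: tS2.
Qed.

Lemma ramsey_exists (m n : nat) : exists k : nat, `[< ramsey_prop m n k >].
Proof.
have [N hN] := ramsey_bound m n; exists N; apply/asboolP=> T arc cT og.
have hT : N <= #|[set: T]| by rewrite cardsT cT.
by have [[S [_ ? ?]]|[S [_ ? ?]]] := hN T arc [set: T] og hT;
  [left|right]; exists S.
Qed.

(* [oramsey m n] is r(I_m, L_n). *)
Definition oramsey (m n : nat) : nat := ex_minn (ramsey_exists m n).

Definition log2 (R : realType) (x : R) : R := (ln x / ln 2)%R.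

(* Main.v *)
Require Import Defs.
From mathcomp Require Import all_boot all_order all_algebra.
From mathcomp Require Import boolp reals exp.
From mathcomp Require Import zify ring lra.

Set Implicit Arguments.
Unset Strict Implicit.
Unset Printing Implicit Defensive.

(** Induction on [n]. In a graph without [I_m] and [L_n], out-neighbourhoods
    have no [L_(n-1)] and common out-neighbourhoods of the ends of an arc have
    no [L_(n-2)]; writing [D] and [E] for the bounds on their sizes, there are
    at most [N D E] transitive triangles. A random set of vertices of density
    about [K / D], for a small power [K] of [m], therefore keeps few
    transitive triangles, and deleting a vertex from each of them leaves a
    graph of degree about [K] in which the neighbourhood of every vertex is
    bipartite (out- and in-neighbours are independent). For such graphs the
    Shearer-Alon argument applies: a uniformly random independent set [W] has
    expected size at least a constant times [log K / K] times the number of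
    vertices, because, given [W] away from [v] and its neighbours, either [v]
    belongs to [W] with substantial probability or [W] contains many
    neighbours of [v]. Hence [N <= C D m / log m], which is the recursion
    satisfied by the bound. *)

(** * Independent sets in locally bipartite graphs *)

(** The binomial expansion of [(1 + b) ^ #|X|], with its terms spread over the subsets of each
    size. *)
Lemma sum_subsets_expn (T : finType) (X : {set T}) (b : nat) :
  \sum_(J : {set T} | J \subset X) b ^ (#|X| - #|J|) = b.+1 ^ #|X|.
Proof.
rewrite -addn1 expnDn.
rewrite (partition_big (fun J : {set T} => inord #|J| : 'I_#|X|.+1) predT) //=.
apply: eq_bigr => i _; rewrite exp1n muln1 -cards_draws.
rewrite -sum_nat_const; apply: congr_big => // [J|J].
  rewrite inE; case: (boolP (J \subset X)) => //= /subset_leq_card JX.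
  by rewrite -val_eqE /= inordK.
by case/andP=> /subset_leq_card JX /eqP<-; rewrite inordK.
Qed.

(** If [#|J| < k] then [8 ^ #|X| <= 8 ^ k * 8 ^ (#|X| - #|J|)], and over all subsets of [X] the last
    factors sum to [9 ^ #|X|]. *)
Lemma card_small_subsets (T : finType) (X : {set T}) (F : {set {set T}}) k :
  (forall J, J \in F -> J \subset X) ->
  #|[set J in F | #|J| < k]| * 8 ^ #|X| <= 8 ^ k * 9 ^ #|X|.
Proof.
move=> FX; rewrite -(sum_subsets_expn X 8) -sum_nat_const big_distrr /=.
rewrite [leqRHS]big_mkcond [leqLHS]big_mkcond; apply: leq_sum => J _.
rewrite !inE; case: ifP => // /andP[JF Jk].
rewrite FX // -expnD leq_exp2l //.
by move: (subset_leq_card (FX _ JF)); lia.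
Qed.

(* Few members of [F] are smaller than [2 l]: if [a] is their number, the
   generating function of the subsets of [X] gives [a ^ 2 <= (8 ^ (2 l)) ^ 2
   #|F|], so [2 a <= #|F| + 8 ^ (4 l)] by AM-GM. *)
Lemma sum_card_large_family (T : finType) (X : {set T}) (F : {set {set T}}) l :
  (forall J, J \in F -> J \subset X) -> 2 ^ #|X| <= #|F| ^ 2 ->
  l * #|F|.+1 <= l * (2 ^ (12 * l)).+1 + \sum_(J in F) #|J|.
Proof.
move=> FX cF; set a := #|[set J in F | #|J| < 2 * l]|.
have ha := card_small_subsets (2 * l) FX; rewrite -/a in ha.
set x := #|X| in ha cF; set N := #|F| in cF *.
(* The base 8 works because [9 ^ 4 <= 2 * 8 ^ 4], while [2 ^ x <= N ^ 2]. *)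
have h98 : (9 ^ x) ^ 2 <= (8 ^ x) ^ 2 * N.
  have pow4 b : ((b ^ x) ^ 2) ^ 2 = (b ^ 4) ^ x.
    by rewrite -!expnM; congr (_ ^ _); lia.
  rewrite -leq_sqr expnMn !pow4; apply: leq_trans (leq_mul (leqnn _) cF).
  rewrite -expnMn; case: (x) => [|y]; first by rewrite !expn0.
  by rewrite leq_exp2r //; vm_compute.
have sq : a ^ 2 <= 2 ^ (12 * l) * N.
  rewrite -(@leq_pmul2r ((8 ^ x) ^ 2)) ?expn_gt0 // -expnMn.
  apply: leq_trans (_ : (8 ^ (2 * l) * 9 ^ x) ^ 2 <= _);
    first by rewrite leq_sqr.
  have -> : 2 ^ (12 * l) = (8 ^ (2 * l)) ^ 2.
    by rewrite -expnM -(expnM 2 3); congr (2 ^ _); lia.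
  by rewrite expnMn -mulnA leq_mul2l (mulnC N) h98 orbT.
have am : 2 * a <= N + 2 ^ (12 * l).
  rewrite -leq_sqr; apply: leq_trans (nat_AGM2 _ _).
  by rewrite expnMn leq_mul2l /= mulnC.
have hs : 2 * l * N <= 2 * l * a + \sum_(J in F) #|J|.
  rewrite /N -sum1_card big_distrr /=.
  rewrite /a -sum1_card big_distrr /= (big_mkcond (fun J => J \in [set _ in _ |
    _])).
  rewrite [leqLHS]big_mkcond [X in _ + X]big_mkcond -big_split /=.
  apply: leq_sum => J _; rewrite !inE; case: (J \in F) => //=.
  by case: ltnP => h /=; lia.
nia.
Qed.

Definition indepb (T : finType) (e : rel T) (S : {set T}) : bool :=
  [forall x in S, forall y in S, ~~ e x y].

Lemma indepP (T : finType) (e : rel T) (S : {set T}) :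
  reflect (independent_set e S) (indepb e S).
Proof.
apply: (iffP 'forall_in_'forall_in_idP) => h x; first by move=> y xS; exact: h.
by move=> xS y; exact: h.
Qed.

Lemma indepb_subset (T : finType) (e : rel T) (S S' : {set T}) :
  S \subset S' -> indepb e S' -> indepb e S.
Proof.
move=> /subsetP SS' /indepP iS; apply/indepP=> x y xS yS.
by apply: iS; exact: SS'.
Qed.

(** All subsets of [A :&: X] and all subsets of [B :&: X] are independent; multiplying the two lower
    bounds on the count gives the square. *)
Lemma card_indep_bipartite (T : finType) (e : rel T) (X A B : {set T}) :
  X \subset A :|: B -> indepb e A -> indepb e B ->
  2 ^ #|X| <= #|[set J : {set T} | (J \subset X) && indepb e J]| ^ 2.
Proof.
move=> XAB iA iB; set F := [set J | _].
have sub C : indepb e C -> 2 ^ #|C :&: X| <= #|F|.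
  move=> iC; rewrite -card_powerset; apply/subset_leq_card/subsetP=> J.
  rewrite !inE => JCX; rewrite (subset_trans JCX (subsetIr _ _)).
  exact: indepb_subset (subset_trans JCX (subsetIl _ _)) iC.
apply: leq_trans (leq_mul (sub _ iA) (sub _ iB)); rewrite -expnD leq_exp2l //.
apply: leq_trans (leq_card_setU _ _); rewrite -setIUl.
by apply: subset_leq_card; rewrite subsetI XAB subxx.
Qed.

(* The inequality holds on every class of independent sets [W] with a given [W
   :\: (v |: N)], [N] the neighbourhood of [v]: besides [v |: Z], such a class
   consists of the [Z :|: J] with [J] independent among the vertices of [N]
   without neighbour in [Z]. *)
Lemma indep_occupancy (T : finType) (e : rel T) (S A B : {set T}) v l :
  symmetric e -> irreflexive e -> v \in S ->
  [set u in S | e v u] \subset A :|: B -> indepb e A -> indepb e B ->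
  l * #|[set W : {set T} | (W \subset S) && indepb e W]| <=
  \sum_(W : {set T} | (W \subset S) && indepb e W)
    (l * (2 ^ (12 * l)).+1 * (v \in W) + #|[set u in S | e v u] :&: W|).
Proof.
move=> sym irr vS NAB iA iB; set N := [set u in S | e v u] in NAB *.
set w := l * _.+1.
rewrite -sum1_card big_distrr /= (eq_bigl (fun W : {set T} => (W \subset S) &&
  indepb e W));
  last by move=> W; rewrite inE.
rewrite (partition_big (fun W : {set T} => W :\: (v |: N)) predT) //=.
rewrite [leqRHS](partition_big (fun W : {set T} => W :\: (v |: N)) predT) //=.
apply: leq_sum => Z _.
have [/existsP[W0 /andP[/andP[W0S iW0] /eqP eZ]]|/existsPn no] :=
  boolP [exists W : {set T}, (W \subset S) && indepb e W && (W :\: (v |: N) ==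
    Z)];
  last by rewrite big_pred0 // => W; apply/negbTE/no.
have ZW0 : Z \subset W0 by rewrite -eZ subsetDl.
have ZS := subset_trans ZW0 W0S.
have iZ := indepb_subset ZW0 iW0.
have vZ : v \notin Z by rewrite -eZ !inE eqxx.
have ZN z : z \in Z -> z \notin N.
  by rewrite -eZ in_setD in_setU negb_or => /andP[/andP[]].
have vN : v \notin N by rewrite inE irr andbF.
have NS : N \subset S by apply/subsetP=> u; rewrite inE => /andP[].
(* The neighbours of [v] that can still be added to [Z]. *)
pose X := [set u in N | [forall z in Z, ~~ e u z]].
pose F := [set J : {set T} | (J \subset X) && indepb e J].
have XN : X \subset N by apply/subsetP=> u; rewrite inE => /andP[].
have ZNJ (J : {set T}) : J \subset X -> (Z :|: J) :&: N = J.
  move=> JX; rewrite setIUl (setIidPl (subset_trans JX XN)).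
  suff -> : Z :&: N = set0 by rewrite set0U.
  by apply/setP=> z; rewrite !in_setI in_set0;
    case: (boolP (z \in Z)) => // /ZN/negbTE.
have PE (J : {set T}) : [&& (Z :|: J \subset S) && indepb e (Z :|: J),
    (Z :|: J) :\: (v |: N) == Z, v \notin Z :|: J & (Z :|: J) :&: N == J]
    = (J \in F).
  rewrite [J \in F]inE; apply/idP/idP.
    case/and4P=> /andP[ZJS iZJ] /eqP eqZ vZJ /eqP eJ; apply/andP; split;
      last first.
      by apply: indepb_subset iZJ; exact: subsetUr.
    apply/subsetP=> u uJ; rewrite inE; apply/andP; split.
      by move: uJ; rewrite -eJ in_setI => /andP[].
    apply/forall_inP=> z zZ; move/indepP: iZJ; apply;
      rewrite inE ?uJ ?zZ ?orbT //.
  case/andP=> JX iJ; rewrite ZNJ // eqxx andbT subUset ZS /=.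
  have JN := subset_trans JX XN.
  rewrite (subset_trans JN NS) /= !inE negb_or vZ /=.
  have vJ : v \notin J by apply: contra vN; exact: (subsetP JN).
  rewrite vJ andbT; apply/andP; split; last first.
    apply/eqP/setP=> u; rewrite !inE.
    case: (boolP (u \in Z)) => uZ.
      have := ZN _ uZ; rewrite inE => /negbTE->; rewrite orbF andbT.
      by apply: contra vZ => /eqP<-.
    case: (boolP (u \in J)) => uJ; last by rewrite andbF.
    by have := subsetP JN _ uJ; rewrite inE => ->; rewrite orbT.
  have XZ u z : u \in J -> z \in Z -> ~~ e u z.
    by move=> /(subsetP JX); rewrite inE => /andP[_ /forall_inP]; exact.
  apply/indepP=> x y; rewrite !inE => /orP[xZ|xJ] /orP[yZ|yJ].
  - exact: (indepP _ _ iZ).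
  - by rewrite sym; exact: XZ.
  - exact: XZ.
  - exact: (indepP _ _ iJ).
have WE (W : {set T}) : [&& (W \subset S) && indepb e W,
    W :\: (v |: N) == Z & v \in W] = (W == v |: Z).
  apply/idP/eqP=> [/and3P[/andP[WS iW] /eqP <- vW]|->].
    apply/setP=> u; rewrite !inE; case: (eqVneq u v) => [->//|uv] /=.
    case: (boolP (u \in W)) => uW; last by rewrite andbF.
    by rewrite andbT (negbTE (indepP _ _ iW _ _ vW uW)) andbF.
  rewrite subUset sub1set vS ZS /= setU11 andbT; apply/andP; split.
    have vz z : z \in Z -> ~~ e v z.
      by move=> zZ; have := ZN _ zZ; rewrite inE (subsetP ZS).
    apply/indepP=> x y; rewrite !inE => /predU1P[->|xZ] /predU1P[->|yZ].
    - by rewrite irr.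
    - exact: vz.
    - by rewrite sym vz.
    - exact: (indepP _ _ iZ).
  apply/eqP/setP=> u; rewrite !inE; case: (eqVneq u v) => [->|uv] /=.
    by rewrite (negbTE vZ).
  case: (boolP (u \in Z)) => uZ; last by rewrite andbF.
  by have := ZN _ uZ; rewrite inE => ->.
have splitv (f : {set T} -> nat) :
    \sum_(W : {set T} | (W \subset S) && indepb e W && (W :\: (v |: N) == Z)) f
      W =
    f (v |: Z) + \sum_(J in F) f (Z :|: J).
  rewrite (bigID (fun W : {set T} => v \in W)) /=; congr (_ + _).
    by rewrite (big_pred1 (v |: Z)) // => W; rewrite -andbA WE.
  rewrite (reindex_onto (fun J => Z :|: J) (fun W => W :&: N)) /=.
    by apply: eq_bigl => J; rewrite -PE !andbA.
  move=> W /andP[/andP[_ /eqP<-] vW]; apply/setP=> u; rewrite !inE.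
  case: (eqVneq u v) => [->|_] /=; first by rewrite (negbTE vW).
  by case: (u \in W) => //=; rewrite ?andbF // andbT orNb.
rewrite !splitv setU11 muln1 sum_nat_const.
(* The one set containing [v] pays [w]; each set [Z :|: J] pays [#|J|], its number of neighbours of
   [v]. *)
apply: leq_trans (_ : w + \sum_(J in F) #|J| <= _).
  have := @sum_card_large_family T X F l _ _; rewrite mulnS (mulnC l #|F|);
    apply.
    by move=> J; rewrite inE => /andP[].
  by apply: card_indep_bipartite iA iB; exact: subset_trans XN NAB.
rewrite -addnA muln1 leq_add2l; apply: leq_trans (leq_addl _ _).
apply: leq_sum => J; rewrite inE => /andP[JX _].
by rewrite setIC ZNJ // leq_addl.
Qed.

(** Sum the occupancy inequality over all [v] and exchange sums: each independent [W] receives the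
    weight times [#|W|], plus the degrees of its vertices. Dividing by the number of independent
    sets gives the bound. *)
Lemma locally_bipartite_indep (T : finType) (e : rel T) (S : {set T}) d a l :
  symmetric e -> irreflexive e ->
  (forall v, v \in S -> exists A B : {set T},
     [/\ [set u in S | e v u] \subset A :|: B, indepb e A & indepb e B]) ->
  (forall v, v \in S -> #|[set u in S | e v u]| <= d) ->
  (forall W : {set T}, W \subset S -> indepb e W -> #|W| <= a) ->
  #|S| * l <= (l * (2 ^ (12 * l)).+1 + d) * a.
Proof.
move=> sym irr bip deg alpha; set w := l * _.+1.
pose P (W : {set T}) := (W \subset S) && indepb e W.
pose I := [set W | P W].
have I0 : 0 < #|I|.
  by apply/card_gt0P; exists set0; rewrite inE /P sub0set; apply/indepP=> x y;
    rewrite inE.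
rewrite -(leq_pmul2r I0).
apply: leq_trans (_ : \sum_(v in S) \sum_(W | P W)
    (w * (v \in W) + #|[set u in S | e v u] :&: W|) <= _).
  rewrite -mulnA -sum_nat_const; apply: leq_sum => v vS.
  have [A [B [NAB iA iB]]] := bip v vS.
  exact: indep_occupancy vS NAB iA iB.
rewrite exchange_big /= [leqRHS]mulnC -sum_nat_const [leqRHS]big_mkcond
  [leqLHS]big_mkcond.
apply: leq_sum => W _; rewrite inE; case: ifP => // /andP[WS iW].
rewrite big_split /= -big_distrr /= mulnDl.
have WSE : W :&: S = W by apply/setIidPl.
have cW : \sum_(v in S) (v \in W) = #|W|.
  rewrite -sum1_card -{2}WSE (eq_bigr (fun v => if v \in W then 1 else 0));
    last by move=> v _; case: (_ \in _).
  by rewrite -big_mkcondr /=; apply: eq_bigl => v; rewrite inE andbC.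
rewrite cW; apply: leq_add; first by rewrite leq_mul2l alpha // orbT.
apply: leq_trans (_ : d * #|W| <= _); last by rewrite leq_mul2l alpha // orbT.
have -> : \sum_(v in S) #|[set u in S | e v u] :&: W| =
    \sum_(u in W) #|[set v in S | e u v]|.
  transitivity (\sum_(v in S) \sum_(u in W) (e v u : nat)).
    apply: eq_bigr => v vS; rewrite -sum1_card big_mkcond [RHS]big_mkcond /=.
    apply: eq_bigr => u _; rewrite !inE; case: (boolP (u \in W)) => uW;
      last by rewrite andbF.
    by rewrite (subsetP WS) //=; case: (e v u).
  rewrite exchange_big; apply: eq_bigr => u uW.
  rewrite -sum1_card big_mkcond [RHS]big_mkcond /=; apply: eq_bigr => v _.
  by rewrite !inE sym; case: (v \in S) => //=; case: (e u v).
by rewrite mulnC -sum_nat_const; apply: leq_sum => u uW; apply: deg;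
  exact: (subsetP WS).
Qed.

(** * Random sparse subgraphs *)

Lemma card_pairs (T U : finType) (Q : T -> pred U) :
  #|[set p : T * U | Q p.1 p.2]| = \sum_x #|[set y | Q x y]|.
Proof.
rewrite -sum1_card (eq_bigl (fun p : T * U => predT p.1 && Q p.1 p.2));
  last by move=> p; rewrite inE.
rewrite -(pair_big_dep predT Q (fun _ _ => 1)) /=.
by apply: eq_bigr => x _; rewrite -sum1_card; apply: eq_bigl => y; rewrite inE.
Qed.

(** For uniform [f] this is a random set containing each vertex independently with probability
    [1 / q.+1]; counting functions replaces probabilities. *)
Definition zero_set (T : finType) q (f : {ffun T -> 'I_q.+1}) : {set T} :=
  [set x | f x == ord0].

Lemma card_sup_zero_set (T : finType) q (A : {set T}) :
  #|[set f : {ffun T -> 'I_q.+1} | A \subset zero_set f]| * q.+1 ^ #|A| =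
  q.+1 ^ #|T|.
Proof.
have -> : #|[set f : {ffun T -> 'I_q.+1} | A \subset zero_set f]| =
          #|pffun_on (ord0 : 'I_q.+1) (~: A) predT|.
  apply: eq_card => f; rewrite inE; apply/idP/pffun_onP => [/subsetP
    Af|[/subsetP sf _]].
    split=> //; apply/subsetP=> x; rewrite !inE; apply: contra => /Af.
    by rewrite inE.
  apply/subsetP=> x xA; rewrite inE; apply: contraLR xA => fx.
  by have := sf x; rewrite !inE; apply.
rewrite card_pffun_on (eq_card (_ : _ =i 'I_q.+1)) // card_ord -expnD.
by rewrite addnC cardsC.
Qed.

(** Linearity of expectation with denominators cleared: each [V i] survives for a fraction
    [1 / q.+1 ^ k] of the functions. *)
Lemma sum_card_sup_zero_set (T I : finType) q k (P : {set I}) (V : I -> {set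
  T}) :
  (forall i, i \in P -> #|V i| = k) ->
  (\sum_(f : {ffun T -> 'I_q.+1}) #|[set i in P | V i \subset zero_set f]|) *
    q.+1 ^ k = #|P| * q.+1 ^ #|T|.
Proof.
move=> Vk.
have -> : \sum_(f : {ffun T -> 'I_q.+1}) #|[set i in P | V i \subset zero_set
  f]| =
    \sum_(i in P) #|[set f : {ffun T -> 'I_q.+1} | V i \subset zero_set f]|.
  transitivity (\sum_(f : {ffun T -> 'I_q.+1}) \sum_(i in P) (V i \subset
    zero_set f : nat)).
    apply: eq_bigr => f _; rewrite -sum1_card big_mkcond [RHS]big_mkcond /=.
    by apply: eq_bigr => i _; rewrite inE; case: (i \in P) => //=;
      case: (V i \subset _).
  rewrite exchange_big; apply: eq_bigr => i _;
    rewrite -sum1_card big_mkcond [RHS]big_mkcond /=.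
  by apply: eq_bigr => f _; rewrite inE; case: (V i \subset _).
rewrite big_distrl /= -sum_nat_const; apply: eq_bigr => i iP.
by rewrite -(Vk i iP) card_sup_zero_set.
Qed.

Definition arcs_in (T : finType) (arc : rel T) (S : {set T}) : {set T * T} :=
  [set p | [&& p.1 \in S, p.2 \in S & arc p.1 p.2]].

(** In an oriented graph these are the transitive triangles, each listed once as source, middle,
    sink; cyclic ones are left out. *)
Definition triangles_in (T : finType) (arc : rel T) (S : {set T}) :
    {set (T * T) * T} :=
  [set p | (p.1 \in arcs_in arc S) &&
           [&& p.2 \in S, arc p.1.1 p.2 & arc p.1.2 p.2]].

Lemma card_arcs_in (T : finType) (arc : rel T) (S : {set T}) :
  #|arcs_in arc S| = \sum_(x in S) #|[set y in S | arc x y]|.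
Proof.
rewrite /arcs_in (card_pairs (fun x y => [&& x \in S, y \in S & arc x y])).
rewrite [RHS]big_mkcond /=; apply: eq_bigr => x _; case: (x \in S) => //=.
by rewrite -[RHS](@cards0 T); apply: eq_card => y; rewrite !inE.
Qed.

Lemma card_arcs_in_rev (T : finType) (arc : rel T) (S : {set T}) :
  #|arcs_in arc S| = #|arcs_in (fun x y => arc y x) S|.
Proof.
have inj : injective (fun p : T * T => (p.2, p.1)) by move=> [? ?] [? ?] [->
  ->].
rewrite -(card_imset (mem (arcs_in arc S)) inj); apply/esym/eq_card => -[x y].
rewrite inE; apply/and3P/imsetP => [[xS yS a]|[[x' y']]]; last first.
  by rewrite inE => /and3P[? ? ?] [-> ->].
by exists (y, x) => //; rewrite inE /= xS yS.
Qed.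

Lemma card_triangles_in (T : finType) (arc : rel T) (S : {set T}) :
  #|triangles_in arc S| =
  \sum_(p in arcs_in arc S) #|[set z in S | arc p.1 z && arc p.2 z]|.
Proof.
rewrite /triangles_in (card_pairs (fun p z => (p \in arcs_in arc S) && [&& z
  \in S, arc p.1 z & arc p.2 z])).
rewrite [RHS]big_mkcond /=; apply: eq_bigr => p _; case: (p \in _) => //=.
by rewrite -[RHS](@cards0 T); apply: eq_card => y; rewrite !inE.
Qed.

(* A uniform colouring with [q.+1] colours: the expected sizes of a colour
   class, of its arcs and of its triangles are [#|A| / q.+1], [#|arcs| / q.+1
   ^ 2] and [#|triangles| / q.+1 ^ 3]. *)
Lemma exists_sparse_sample (T : finType) (arc : rel T) (A : {set T}) q K D E :
  irreflexive arc ->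
  (forall x, x \in A -> #|[set y in A | arc x y]| <= D) ->
  (forall x y, x \in A -> y \in A -> arc x y ->
     #|[set z in A | arc x z && arc y z]| <= E) ->
  4 * D <= K * q.+1 -> 4 * D * E <= q.+1 ^ 2 ->
  exists2 S : {set T}, S \subset A &
    K * #|A| + 4 * q.+1 * (K * #|triangles_in arc S| + 2 * #|arcs_in arc S|) <=
    4 * q.+1 * K * #|S|.
Proof.
move=> irr hD hE hKq hq.
have hP2 : #|arcs_in arc A| <= #|A| * D.
  by rewrite card_arcs_in -sum_nat_const; apply: leq_sum.
have hP3 : #|triangles_in arc A| <= #|A| * D * E.
  apply: leq_trans (leq_mul hP2 (leqnn E));
    rewrite card_triangles_in -sum_nat_const.
  by apply: leq_sum => -[x y]; rewrite inE => /and3P[? ? ?]; exact: hE.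
pose V1 (x : T) := [set x]; pose V2 (p : T * T) := [set p.1; p.2].
pose V3 (p : T * T * T) := p.2 |: V2 p.1.
have neq x y : arc x y -> x != y by apply: contraTneq => ->; rewrite irr.
have c2 p : p \in arcs_in arc A -> #|V2 p| = 2.
  by rewrite inE => /and3P[_ _ /neq xy]; rewrite cards2 xy.
have c3 p : p \in triangles_in arc A -> #|V3 p| = 3.
  rewrite inE => /andP[/c2 c2p /and3P[_ /neq xz /neq yz]].
  by rewrite cardsU1 c2p !inE negb_or eq_sym xz eq_sym yz.
have h1 := @sum_card_sup_zero_set T T q 1 A V1 (fun i _ => cards1 i).
have h2 := @sum_card_sup_zero_set T _ q 2 _ V2 c2.
have h3 := @sum_card_sup_zero_set T _ q 3 _ V3 c3.
have subset1 f : [set i in A | V1 i \subset @zero_set T q f] = A :&: zero_set f.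
  by apply/setP=> x; rewrite !inE sub1set inE.
have subset2 f : [set p in arcs_in arc A | V2 p \subset @zero_set T q f] =
    arcs_in arc (A :&: zero_set f).
  apply/setP=> -[x y]; rewrite /V2 !inE subUset !sub1set !inE /=.
  case: (x \in A) => //=; case: (y \in A) => //=; rewrite ?andbF //.
  by case: (f x == _); case: (f y == _); rewrite ?andbF ?andbT.
have subset3 f : [set p in triangles_in arc A | V3 p \subset @zero_set T q f] =
    triangles_in arc (A :&: zero_set f).
  apply/setP=> -[[x y] z]; rewrite /V3 /V2 !inE !subUset !sub1set !inE /=.
  case: (x \in A) => //=; case: (y \in A) => //=; rewrite ?andbF //.
  case: (z \in A) => //=; rewrite ?andbF //.
  by case: (f x == _); case: (f y == _); case: (f z == _);
    rewrite ?andbF ?andbT.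
have [/existsP[f hf]|/existsPn no] := boolP [exists f : {ffun T -> 'I_q.+1},
    K * #|A| + 4 * q.+1 * (K * #|triangles_in arc (A :&: zero_set f)| +
      2 * #|arcs_in arc (A :&: zero_set f)|) <= 4 * q.+1 * K * #|A :&: zero_set
        f|].
  by exists (A :&: zero_set f); first exact: subsetIl.
exfalso.
(* If every colouring fails, each does so by at least 1, so the sum over colourings has an excess of
   [q.+1 ^ #|T|], to be refuted by the averages. *)
have : \sum_(f : {ffun T -> 'I_q.+1}) (4 * q.+1 * K * #|A :&: zero_set f|).+1 <=
  \sum_(f : {ffun T -> 'I_q.+1}) (K * #|A| + 4 * q.+1 * (K * #|triangles_in arc
    (A :&: zero_set f)| +
      2 * #|arcs_in arc (A :&: zero_set f)|)).
  by apply: leq_sum => f _; rewrite ltnNge no.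
under eq_bigr do rewrite -addn1 -subset1.
under [X in _ <= X]eq_bigr do rewrite -subset2 -subset3.
have lin (a b k : nat) (g h : {ffun T -> 'I_q.+1} -> nat) :
    \sum_f (a + b * (K * g f + k * h f)) =
    q.+1 ^ #|T| * a + b * (K * (\sum_f g f) + k * \sum_f h f).
  rewrite big_split sum_nat_const card_ffun card_ord; congr (_ + _).
  by rewrite -big_distrr big_split -!big_distrr.
rewrite lin big_split -big_distrr sum_nat_const card_ffun card_ord {lin}.
move: h1 h2 h3.
set s1 := \sum_f #|[set i in A | _]|.
set s2 := \sum_f #|[set i in arcs_in arc A | _]|.
set s3 := \sum_f #|[set i in triangles_in arc A | _]|.
have : 0 < q.+1 ^ #|T| by rewrite expn_gt0.
move: hKq hq hP2 hP3.
move: (q.+1 ^ #|T|) #|A| #|arcs_in arc A| #|triangles_in arc A| s1 s2 s3.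
have : 0 < q.+1 by [].
move: (q.+1) => {subset1 subset2 subset3 no} c c0 Q N e t s1 s2 s3 hKq hq hP2
  hP3 Q0.
rewrite expn1 => h1 h2 h3.
have h4e : 4 * e <= K * c * N by nia.
have h4t : 4 * t <= c ^ 2 * N by nia.
rewrite muln1 => hs; suff : Q * c ^ 2 <= 0 by rewrite leqn0 muln_eq0 expn_eq0;
  lia.
have {hs} : (4 * c * K * s1 + Q) * c ^ 2 <=
    (Q * (K * N) + 4 * c * (K * s3 + 2 * s2)) * c ^ 2 by apply: leq_mul.
have -> : (4 * c * K * s1 + Q) * c ^ 2 = 4 * K * (N * Q) * c ^ 2 + Q * c ^ 2.
  by rewrite -h1; ring.
have -> : (Q * (K * N) + 4 * c * (K * s3 + 2 * s2)) * c ^ 2 =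
    Q * (K * N) * c ^ 2 + K * Q * (4 * t) + 2 * c * Q * (4 * e).
  transitivity (Q * (K * N) * c ^ 2 + 4 * K * (s3 * c ^ 3) + 8 * c * (s2 * c ^
    2)).
    by rewrite !expnS; ring.
  by rewrite h2 h3; ring.
have := leq_mul (leqnn (K * Q)) h4t; have := leq_mul (leqnn (2 * c * Q)) h4e.
have -> : 2 * c * Q * (K * c * N) = 2 * (K * (N * Q) * c ^ 2) by rewrite
  !expnS; ring.
have -> : K * Q * (c ^ 2 * N) = K * (N * Q) * c ^ 2 by ring.
have -> : Q * (K * N) * c ^ 2 = K * (N * Q) * c ^ 2 by ring.
(* In units of [K * (N * Q) * c ^ 2], the left side is 4 plus the positive excess [Q * c ^ 2]; on
   the right the main term is 1, triangles give at most 1 and arcs at most 2. *)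
rewrite -!(mulnA 4); set M := K * _ * _; set X := _ * (4 * e);
  set Y := _ * (4 * t).
lia.
Qed.

(** Delete the source of each triangle and every vertex of out- or in-degree above [K]. Counting
    arcs by tail and by head, [K] times the number of vertices deleted for their degree is at most
    twice the number of arcs. *)
Lemma exists_triangle_free_subset (T : finType) (arc : rel T) (S : {set T}) K :
  exists2 S' : {set T}, S' \subset S &
  [/\ K * #|S| <= K * #|S'| + (K * #|triangles_in arc S| + 2 * #|arcs_in arc
    S|),
      triangles_in arc S' = set0,
      forall v, v \in S' -> #|[set u in S' | arc v u]| <= K &
      forall v, v \in S' -> #|[set u in S' | arc u v]| <= K].
Proof.
pose B3 := [set p.1.1 | p in triangles_in arc S].
pose big (a : rel T) := [set v in S | K < #|[set u in S | a v u]|].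
have bigK a : K * #|big a| <= #|arcs_in a S|.
  rewrite mulnC -sum_nat_const card_arcs_in big_mkcond [leqRHS]big_mkcond /=.
  apply: leq_sum => v _; rewrite inE; case: (v \in S) => //=.
  by case: ifP => // /ltnW.
pose arc' : rel T := fun x y => arc y x.
pose S' := S :\: (B3 :|: big arc :|: big arc').
have S'S : S' \subset S := subsetDl _ _.
have deg a v : v \in S' -> v \notin big a -> #|[set u in S' | a v u]| <= K.
  move=> vS'; rewrite inE (subsetP S'S) //= -leqNgt; apply: leq_trans.
  apply/subset_leq_card/subsetP=> u; rewrite !inE => /andP[uS' ->].
  by rewrite andbT; move: uS'; case: (u \in S); rewrite ?andbF.
have notB v : v \in S' -> [/\ v \notin B3, v \notin big arc & v \notin big
  arc'].
  by rewrite in_setD !in_setU !negb_or => /andP[/andP[/andP[]]].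
exists S' => //; split.
- have cB : #|B3 :|: big arc :|: big arc'| <= #|triangles_in arc S| + #|big
  arc| + #|big arc'|.
    apply: leq_trans (leq_card_setU _ _) _; rewrite leq_add2r.
    apply: leq_trans (leq_card_setU _ _) _; rewrite leq_add2r.
    exact: leq_imset_card.
  have : #|S| <= #|S'| + (#|triangles_in arc S| + #|big arc| + #|big arc'|).
    rewrite -(cardsID (B3 :|: big arc :|: big arc') S) addnC leq_add2l.
    exact: leq_trans (subset_leq_card (subsetIr _ _)) cB.
  have := bigK arc; have := bigK arc'; rewrite -card_arcs_in_rev.
  by move=> ? ? ?; nia.
- apply/eqP; rewrite -subset0; apply/subsetP=> p pS'.
  have [] := notB p.1.1; first by move: pS'; rewrite !inE => /andP[/and3P[]].
  case/negP; apply/imsetP; exists p => //.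
  move: pS'; rewrite 2!inE => /andP[/and3P[h1 h2 h] /and3P[h3 ? ?]].
  by rewrite 2!inE h !(subsetP S'S) //=; apply/andP.
- by move=> v vS'; have [_ h _] := notB v vS'; exact: deg.
- by move=> v vS'; have [_ _ h] := notB v vS'; exact: (deg arc').
Qed.

(** After sampling and deletion, an arc among the out-neighbours or among the in-neighbours of a
    vertex would complete a transitive triangle. The underlying undirected graph is thus locally
    bipartite, of degree at most [2 * K]. *)
Lemma card_bound_of_local_bounds (T : finType) (arc : rel T) (A : {set T})
    q K D E a l :
  irreflexive arc -> 0 < K ->
  (forall x, x \in A -> #|[set y in A | arc x y]| <= D) ->
  (forall x y, x \in A -> y \in A -> arc x y ->
     #|[set z in A | arc x z && arc y z]| <= E) ->
  (forall W : {set T}, W \subset A -> independent_set arc W -> #|W| <= a) ->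
  4 * D <= K * q.+1 -> 4 * D * E <= q.+1 ^ 2 ->
  #|A| * l <= 4 * q.+1 * (l * (2 ^ (12 * l)).+1 + 2 * K) * a.
Proof.
move=> irr K0 hD hE alpha hKq hq.
have [S SA hS] := exists_sparse_sample irr hD hE hKq hq.
have [S' S'S [hS' tf outS inS]] := exists_triangle_free_subset arc S K.
(* The loss from deletion is exactly the quantity charged in the sampling inequality, so the two
   cancel. *)
have cA : #|A| <= 4 * q.+1 * #|S'|.
  rewrite -(leq_pmul2l K0); have := leq_mul (leqnn (4 * q.+1)) hS'; nia.
apply: leq_trans (leq_mul cA (leqnn l)) _; rewrite -!mulnA !leq_mul2l.
do 2! (apply/orP; right).
pose e : rel T := fun x y => arc x y || arc y x.
have eI W : indepb e W -> independent_set arc W.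
  by move=> /indepP iW x y xW yW; have := iW _ _ xW yW;
    rewrite negb_or => /andP[].
have tri x y z : x \in S' -> y \in S' -> z \in S' -> arc x y -> arc y z -> ~~
  arc x z.
  move=> xS yS zS xy yz; apply/negP=> xz.
  have : (x, y, z) \in triangles_in arc S' by rewrite !inE /= xS yS zS xy yz xz.
  by rewrite tf inE.
apply: (@locally_bipartite_indep T e) => [x y|x|v vS|v vS|W WS iW].
- by rewrite /e orbC.
- by rewrite /e irr.
- exists [set u in S' | arc v u], [set u in S' | arc u v]; split.
  + by apply/subsetP=> u; rewrite !inE => /andP[-> /orP[]->]; rewrite ?orbT.
  + apply/indepP=> x y; rewrite !inE => /andP[xS vx] /andP[yS vy].
    apply/norP; split; apply/negP.
      by move=> xy; have /negP := tri _ _ _ vS xS yS vx xy.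
    by move=> yx; have /negP := tri _ _ _ vS yS xS vy yx.
  + apply/indepP=> x y; rewrite !inE => /andP[xS xv] /andP[yS yv].
    apply/norP; split; apply/negP.
      by move=> xy; have /negP := tri _ _ _ xS yS vS xy yv.
    by move=> yx; have /negP := tri _ _ _ yS xS vS yx xv.
- rewrite mul2n -addnn; apply: leq_trans (leq_add (outS v vS) (inS v vS)).
  apply: leq_trans (leq_card_setU _ _); apply/subset_leq_card/subsetP=> u.
  by rewrite !inE => /andP[-> /orP[]->]; rewrite ?orbT.
- by apply: alpha (eI _ iW); exact: subset_trans WS (subset_trans S'S SA).
Qed.

(** * The recursion *)

Lemma transitive_tournament_setU1 (T : finType) (arc : rel T) (S : {set T}) v :
  oriented_graph arc -> (forall y, y \in S -> arc v y) ->
  transitive_tournament arc S -> transitive_tournament arc (v |: S).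
Proof.
move=> [irr asym] vS [tot trans].
have asy x y : arc x y -> arc y x = false.
  move=> xy; have [exy|/asym] := eqVneq x y; last by rewrite xy => /negbTE.
  by rewrite exy irr in xy.
split=> [x y|x y z]; rewrite !inE.
  case/predU1P=> [->|xS] /predU1P[->|yS]; rewrite ?eqxx //.
  - by left; exact: vS.
  - by right; exact: vS.
  - exact: tot.
case/predU1P=> [->|xS] /predU1P[->|yS] /predU1P[->|zS] //.
- by move=> /asy ->.
- by move=> _ _; exact: vS.
- by rewrite (asy _ _ (vS _ xS)).
- by rewrite (asy _ _ (vS _ yS)).
- exact: trans.
Qed.

(** Relative to a subset [A], so that the induction passes to neighbourhoods inside one graph. *)
Definition ramsey_free (T : finType) (arc : rel T) (A : {set T}) m n : Prop :=
  (forall S : {set T}, S \subset A -> independent_set arc S -> #|S| < m) /\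
  (forall S : {set T}, S \subset A -> transitive_tournament arc S -> #|S| < n).

Lemma ramsey_free_out (T : finType) (arc : rel T) (A : {set T}) m n v :
  oriented_graph arc -> v \in A -> ramsey_free arc A m n.+1 ->
  ramsey_free arc [set y in A | arc v y] m n.
Proof.
move=> og vA [hI hL]; have sA : [set y in A | arc v y] \subset A.
  by apply/subsetP=> y; rewrite inE => /andP[].
split=> S SA tS; first exact: hI (subset_trans SA sA) tS.
have vS y : y \in S -> arc v y by move/(subsetP SA); rewrite inE => /andP[].
have vnS : v \notin S by apply/negP=> /vS; rewrite (proj1 og).
have := hL (v |: S); rewrite cardsU1 vnS ltnS; apply.
  by rewrite subUset sub1set vA (subset_trans SA sA).
exact: transitive_tournament_setU1.
Qed.

(** * Logarithms and the choice of parameters *)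

Import Order.TTheory GRing.Theory Num.Theory.
Local Open Scope ring_scope.

Lemma log2_bounds (R : realType) (m : nat) : (0 < m)%N ->
  (trunc_log 2 m)%:R <= log2 (m%:R : R) <= (trunc_log 2 m).+1%:R.
Proof.
move=> m0; have /andP[lo hi] := trunc_log_bounds (isT : (1 < 2)%N) m0.
have ln2 : 0 < ln 2 :> R by apply: ln_gt0; rewrite ltr1n.
rewrite /log2 ler_pdivlMr // ler_pdivrMr // !mulr_natl -!lnXn ?ltr0n //.
by rewrite !ler_ln ?posrE ?exprn_gt0 ?ltr0n // -!natrX !ler_nat lo ltnW.
Qed.

Lemma ltn_max_div (n : nat) : (n < 128 * maxn 1 (n %/ 64))%N.
Proof. by have := divn_eq n 64; have := ltn_pmod n (isT : (0 < 64)%N); lia. Qed.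

(** For large [L0] the weight is at most [2 ^ (14 * l)] and [L0.+1] at most [2 ^ (7 + l)], so
    [64 * l <= L0] leaves ample room. *)
Lemma weight_le_pow_log (R : realType) (L0 : nat) (l := maxn 1 (L0 %/ 64)) :
  (6 <= L0)%N ->
  (l * (2 ^ (12 * l)).+1)%:R ^+ 2 * L0.+1%:R <= 2 ^+ 21 * 2 ^+ L0 :> R.
Proof.
move=> L06; have [L064|L064] := ltnP L0 64.
  have -> : l = 1%N by rewrite /l divn_small.
  rewrite mul1n muln1 -[(2 ^ 12).+1]addn1 natrD natrX.
  (* With [l = 1] the weight is [2 ^ 12 + 1], whose square is below [9 * 2 ^ 21]. The inequality
     fails at [L0 = 5], whence the threshold 6. *)
  have : (9 * L0.+1 <= 2 ^ L0)%N.
    rewrite -(subnKC L06); elim: (L0 - 6)%N => [|k IH]; first by [].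
    by rewrite addnS expnS; lia.
  rewrite -(ler_nat R) natrM natrX; set y := L0.+1%:R; set z := 2 ^+ L0.
  have : 0 <= y by rewrite ler0n.
  by lra.
have l1 : (1 <= l)%N by rewrite leq_maxl.
have hl : (L0 < 128 * l)%N := ltn_max_div L0.
have hl' : (l * 64 <= L0)%N.
  by rewrite /l (maxn_idPr _) ?divn_gt0 // leq_divM.
have lexp : (l <= 2 ^ l)%N by rewrite ltnW // ltn_expl.
have hK : (l * (2 ^ (12 * l)).+1 <= 2 ^ (14 * l))%N.
  have -> : (14 * l = l + (12 * l + l))%N by lia.
  rewrite expnD; apply: leq_mul => //; rewrite expnD.
  have : (0 < 2 ^ (12 * l))%N by rewrite expn_gt0.
  have : (2 <= 2 ^ l)%N by rewrite -{1}(expn1 2) leq_exp2l.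
  nia.
have hL : (L0.+1 <= 2 ^ (7 + l))%N by rewrite expnD; lia.
rewrite -natrX -natrM -exprD -natrX ler_nat.
have hKsq : ((l * (2 ^ (12 * l)).+1) ^ 2 <= 2 ^ (28 * l))%N.
  by have -> : (28 * l = 14 * l * 2)%N; [lia | rewrite (expnM 2 (14 * l))
    leq_sqr].
apply: leq_trans (leq_mul hKsq hL) _.
by rewrite -expnD leq_exp2l //; lia.
Qed.

Lemma recursive_card_bound (R : realType) (m N : nat) (D E : R) :
  let L := log2 (m%:R : R) in
  (2 <= m)%N -> 2 ^+ 19 * m%:R <= D -> 0 <= E -> E * (2 ^+ 19 * m%:R) <= D * L
    ->
  (forall l K q : nat, (0 < K)%N -> 4 * D <= K%:R * q.+1%:R ->
     4 * D * E <= q.+1%:R ^+ 2 ->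
     (N * l <= 4 * q.+1 * (l * (2 ^ (12 * l)).+1 + 2 * K) * m)%N) ->
  N.+1%:R <= D * (2 ^+ 19 * m%:R / L).
Proof.
move=> L m2 mD E0 EL H.
have m0 : (0 < m)%N by lia.
have := log2_bounds R m0; rewrite -/L; set L0 := trunc_log 2 m => /andP[L0L
  LL0].
have powL0 : (2 ^ L0 <= m)%N by have /andP[] := trunc_log_bounds (isT : (1 <
  2)%N) m0.
have L01 : (1 <= L0)%N by rewrite trunc_log_gt0.
have L1 : 1 <= L by apply: le_trans L0L; rewrite ler1n.
have mR : 2 <= m%:R :> R by rewrite (ler_nat R 2).
have D1 : 1 <= D by lra.
have D0 : 0 < D by lra.
have L0m : L0%:R + 1 <= m%:R :> R.
  by rewrite natr1 ler_nat; apply: leq_trans powL0; exact: ltn_expl.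
have Lm : L <= m%:R by rewrite (le_trans LL0) // -natr1.
rewrite mulrA ler_pdivlMr; last by lra.
(* The least natural parameter up to rounding: [K * q.+1] lies between [4 * D] and [4 * D + K]. *)
pose qq (K : nat) := Num.truncn (4 * D / K%:R).
have qqP (K : nat) : (0 < K)%N ->
    4 * D <= K%:R * (qq K).+1%:R /\ K%:R * (qq K).+1%:R <= 4 * D + K%:R.
  move=> K0; have KR : 0 < K%:R :> R by rewrite ltr0n.
  have x0 : 0 <= 4 * D / K%:R by rewrite divr_ge0 //; lra.
  have /andP[lo hi] := truncn_itv x0; rewrite -/(qq K) in lo hi; split.
    by rewrite [leRHS]mulrC -ler_pdivrMr // ltW.
  by rewrite -natr1 mulrDr mulr1 lerD2r [leLHS]mulrC -ler_pdivlMr.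
(* For [L0 < 6] the values [l = K = 1] suffice; otherwise [l] is about [L0 /
   64] and [K] is the weight [l * (2 ^ (12 * l)).+1], so that [K ^ 2 L] is at
   most a constant times [m], which is what [4 D E <= q.+1 ^ 2] requires when
   [q] is about [4 D / K]. *)
have [L06|L06] := ltnP L0 6.
  have [lo hi] := qqP 1%N isT.
  have E1 : E <= D.
    have m19 : m%:R <= 2 ^+ 19 * m%:R :> R by lra.
    have mp : 0 < m%:R :> R by lra.
    rewrite -(ler_pM2r mp).
    apply: le_trans (ler_wpM2l E0 m19) _; apply: le_trans EL _.
    by apply: ler_wpM2l => //; lra.
  have {}H := H 1%N 1%N (qq 1%N) isT lo.
  have {}H : (N * 1 <= 4 * (qq 1%N).+1 * (1 * (2 ^ (12 * 1)).+1 + 2 * 1) * m)%N.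
    apply: H; rewrite mul1r in lo; move: lo; set x := _%:R => lo; nra.
  move: H; rewrite muln1 -(ler_nat R) !natrM natrD -[(_ ^ _).+1]addn1 mul1n
    natrD natrX.
  move: hi; rewrite mul1r; set x := (qq _).+1%:R => hi.
  have Dm : 1 <= D * m%:R by nra.
  have xm : x * m%:R <= 5 * D * m%:R by apply: ler_wpM2r; lra.
  have L6 : L <= 6 by apply: le_trans LL0 _; rewrite ler_nat.
  rewrite -[N.+1]addn1 natrD !muln1; set w := _ + 2%:R => H.
  have w0 : 0 <= w by rewrite /w; lra.
  have NB : N%:R + 1 <= (20 * w + 1) * (D * m%:R).
    have := ler_wpM2l w0 xm;
    have -> : (20 * w + 1) * (D * m%:R) = 4 * (w * (5 * D * m%:R)) + D * m%:R
      by ring.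
    have e : 4 * x * w * m%:R = 4 * (w * (x * m%:R)) by ring.
    by rewrite e in H; lra.
  have N0 : 0 <= N%:R :> R by rewrite ler0n.
  (* Here [w] is 4099, so [2 ^+ 19 = 524288] has to exceed 491886. *)
  have w6 : (20 * w + 1) * 6 <= 2 ^+ 19 by rewrite /w; lra.
  apply: le_trans (_ : (20 * w + 1) * (D * m%:R) * 6 <= _).
    by apply: ler_pM => //; lra.
  by rewrite [leLHS]mulrAC [leRHS]mulrCA; apply: ler_wpM2r => //; lra.
pose l := maxn 1 (L0 %/ 64).
have [K eK] : exists K, K = (l * (2 ^ (12 * l)).+1)%N by eexists.
have l1 : (1 <= l)%N by rewrite leq_maxl.
have K0 : (0 < K)%N by rewrite eK muln_gt0 l1.
have hl : (L0 < 128 * l)%N := ltn_max_div L0.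
have lm : l%:R <= m%:R :> R.
  rewrite ler_nat; apply: leq_trans powL0;
    apply: leq_trans (ltnW (ltn_expl _ _)) => //.
  by rewrite geq_max L01 leq_div.
have K2 : K%:R ^+ 2 * L <= 2 ^+ 21 * m%:R.
  apply: le_trans (_ : K%:R ^+ 2 * L0.+1%:R <= _).
    by apply: ler_wpM2l => //; rewrite exprn_ge0.
  rewrite eK; apply: le_trans (weight_le_pow_log R L06) _.
  by apply: ler_wpM2l; [rewrite exprn_ge0 | rewrite -natrX ler_nat].
have L128 : L <= 128 * l%:R by apply: le_trans LL0 _; rewrite -natrM ler_nat.
have l1R : 1 <= l%:R :> R by rewrite ler1n.
have K1R : 1 <= K%:R :> R by rewrite ler1n.
have [lo hi] := qqP K K0; have {}H := H l K (qq K) K0 lo.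
rewrite -eK in H; move: lo hi H.
have -> : (K + 2 * K = 3 * K)%N by rewrite -{1}[K]mul1n -mulnDl.
set x := (qq K).+1 => lo hi H.
have {}H : (N * l <= 4 * x * (3 * K) * m)%N.
  (* After multiplication by [k ^+ 2 * (2 ^+ 19 * m%:R)], the ratio of [E] to [D] and the bound on
     [k ^+ 2 * L] reduce [4 * D * E <= y ^+ 2] to [4 * D <= k * y]. *)
  apply: H; set k := K%:R in K2 K1R lo hi; set y := x%:R in lo hi *.
  have c0 : 0 < k ^+ 2 * (2 ^+ 19 * m%:R) by rewrite !mulr_gt0 ?exprn_gt0 //;
    lra.
  rewrite -(ler_pM2r c0).
  apply: le_trans (_ : 4 * D * (D * L) * k ^+ 2 <= _).
    have -> : 4 * D * E * (k ^+ 2 * (2 ^+ 19 * m%:R)) =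
        4 * D * (E * (2 ^+ 19 * m%:R)) * k ^+ 2 by ring.
    by apply: ler_wpM2r; [rewrite exprn_ge0 //; lra | apply: ler_wpM2l => //;
      lra].
  apply: le_trans (_ : (4 * D) ^+ 2 * (2 ^+ 19 * m%:R) <= _).
    have -> : 4 * D * (D * L) * k ^+ 2 = 4 * D ^+ 2 * (k ^+ 2 * L) by ring.
    have -> : (4 * D) ^+ 2 * (2 ^+ 19 * m%:R) = 4 * D ^+ 2 * (2 ^+ 21 * m%:R)
      by ring.
    by apply: ler_wpM2l => //; rewrite mulr_ge0 ?exprn_ge0 //; lra.
  rewrite [leRHS]mulrA -exprMn (mulrC y); apply: ler_wpM2r; first by lra.
  by apply: lerXn2r => //; rewrite nnegrE; [lra | rewrite mulr_ge0 ?ler0n //;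
    lra].
move: H; rewrite -(ler_nat R) !natrM => H.
(* Hence rounding at most doubles: [K * q.+1 <= 8 * D]. *)
have KD : K%:R <= 4 * D.
  apply: le_trans (_ : 2 ^+ 21 * m%:R <= _); last by lra.
  apply: le_trans K2; rewrite expr2 -mulrA -{1}[K%:R]mulr1.
  by apply: ler_wpM2l; nra.
have NB : N%:R * l%:R <= 96 * (D * m%:R).
  apply: le_trans H _.
  have -> : 4 * x%:R * (3 * K%:R) * m%:R = 12 * ((K%:R * x%:R) * m%:R) :> R by
    ring.
  have : K%:R * x%:R * m%:R <= 8 * D * m%:R by apply: ler_wpM2r; lra.
  by lra.
have lp : 0 < l%:R :> R by lra.
rewrite -(ler_pM2r lp) -natr1.
have NB' : (N%:R + 1) * l%:R <= 97 * (D * m%:R) by nra.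
have Dm : 0 <= D * m%:R by nra.
(* Since [L <= 128 * l], the factor [l] cancels at the cost of [97 * 128], well below [2 ^+ 19]. *)
have : (N%:R + 1) * l%:R * L <= 97 * (D * m%:R) * L by apply: ler_wpM2r; lra.
have : D * m%:R * L <= D * m%:R * (128 * l%:R) by apply: ler_wpM2l.
have : 0 <= D * m%:R * l%:R by rewrite mulr_ge0 //; lra.
by lra.
Qed.

(** * The bound as a function of [n] *)

(** At [n = 1] truncated subtraction makes both exponents 0, so the value [2 ^+ 19] can start the
    induction. *)
Definition oramsey_ub (R : realType) (m n : nat) : R :=
  2 ^+ (19 * n) * (m%:R ^+ (n - 1) / log2 (m%:R : R) ^+ (n - 2)).

Lemma log2_ge1 (R : realType) (m : nat) : (2 <= m)%N -> 1 <= log2 (m%:R : R).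
Proof.
move=> m2; have /andP[+ _] := log2_bounds R (ltnW m2); apply: le_trans.
by rewrite ler1n trunc_log_gt0.
Qed.

Lemma log2_le (R : realType) (m : nat) : (2 <= m)%N -> log2 (m%:R : R) <= m%:R.
Proof.
move=> m2; have /andP[_] := log2_bounds R (ltnW m2); move/le_trans; apply.
rewrite ler_nat; have /andP[+ _] := trunc_log_bounds (isT : (1 < 2)%N) (ltnW
  m2).
exact/leq_trans/ltn_expl.
Qed.

Lemma oramsey_ub_ge0 (R : realType) (m n : nat) : (2 <= m)%N ->
  0 <= oramsey_ub R m n.
Proof.
move=> /(log2_ge1 R) L1; apply: mulr_ge0; first by rewrite exprn_ge0.
by apply: divr_ge0; apply: exprn_ge0 => //; exact: le_trans L1.
Qed.

Lemma oramsey_ub1 (R : realType) (m : nat) : oramsey_ub R m 1 = 2 ^+ 19.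
Proof. by rewrite /oramsey_ub muln1 (_ : 1 - 2 = 0)%N // subnn !expr0 divr1
  mulr1. Qed.

Lemma oramsey_ub2 (R : realType) (m : nat) :
  oramsey_ub R m 2 = 2 ^+ 19 * (2 ^+ 19 * m%:R).
Proof. by rewrite /oramsey_ub subnn expr0 divr1 expr1 mulrA -exprD. Qed.

Lemma oramsey_ub_rec (R : realType) (m n : nat) : (2 <= m)%N ->
  oramsey_ub R m n.+3 =
  oramsey_ub R m n.+2 * (2 ^+ 19 * m%:R / log2 (m%:R : R)).
Proof.
move=> /(log2_ge1 R) L1; rewrite /oramsey_ub !subSS !subn0 (mulnS 19 n.+2)
  exprD.
set L := log2 _ in L1 *; rewrite ![_ ^+ n.+1]exprS [m%:R ^+ n.+2]exprS ![m%:R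
  ^+ n.+1]exprS.
set M : R := 2 ^+ 19; set M' : R := 2 ^+ (19 * n.+2).
by field; rewrite expf_neq0 ?andbT //; lra.
Qed.

Lemma oramsey_ub_ge (R : realType) (m n : nat) : (2 <= m)%N ->
  2 ^+ 19 * m%:R <= oramsey_ub R m n.+2.
Proof.
move=> m2; have L1 := log2_ge1 R m2; have Lm := log2_le R m2.
elim: n => [|n IH].
  by rewrite oramsey_ub2; lra.
rewrite oramsey_ub_rec //; apply: le_trans IH _.
by rewrite ler_peMr ?oramsey_ub_ge0 // ler_pdivlMr; lra.
Qed.

(** An equality except at [n = 0], where the recurrence lacks its logarithm and [log2 m >= 1] is
    used. *)
Lemma oramsey_ub_ratio (R : realType) (m n : nat) : (2 <= m)%N ->
  oramsey_ub R m n.+1 * (2 ^+ 19 * m%:R) <=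
  oramsey_ub R m n.+2 * log2 (m%:R : R).
Proof.
move=> m2; have L1 := log2_ge1 R m2; case: n => [|n].
  rewrite oramsey_ub1 oramsey_ub2 ler_peMr // !mulr_ge0 ?exprn_ge0 //.
rewrite oramsey_ub_rec // -mulrA divfK //; lra.
Qed.

(** * Induction on [n] and the conclusion *)

Lemma ramsey_free_card (R : realType) (m n : nat) (T : finType) (arc : rel T)
    (A : {set T}) :
  (2 <= m)%N -> oriented_graph arc -> ramsey_free arc A m n.+1 ->
  #|A|.+1%:R <= oramsey_ub R m n.+1.
Proof.
move=> m2 og.
have tt0 : transitive_tournament arc set0 by split=> x y; rewrite inE.
have tt1 x : transitive_tournament arc [set x].
  by rewrite -[[set x]]setU0; apply: transitive_tournament_setU1 => // y;
    rewrite inE.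
(* Two consecutive values are carried, as the recursion uses both. In the base, a set without [L_1]
   is empty and one without [L_2] is independent. *)
suff H k : (forall A, ramsey_free arc A m k.+1 -> #|A|.+1%:R <= oramsey_ub R m
  k.+1) /\
    (forall A, ramsey_free arc A m k.+2 -> #|A|.+1%:R <= oramsey_ub R m k.+2).
  by have [+ _] := H n; exact.
elim: k {n A} => [|n [IH1 IH2]]; split=> // A fA.
- have -> : A = set0.
    apply/setP=> x; rewrite inE; apply/negP=> xA.
    by have := fA.2 [set x]; rewrite sub1set cards1 ltnn => /(_ xA (tt1 x)).
  by rewrite cards0 oramsey_ub1 exprn_ege1 // ler1n.
- have : (#|A| < m)%N.
    apply: fA.1 => // x y xA yA; apply/negP=> xy.
    have := fA.2 [set x; y]; rewrite subUset !sub1set xA yA cards2.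
    have -> : x != y by apply: contraTneq xy => ->; rewrite og.1.
    rewrite ltnn => hxy; suff : false by []; apply: hxy => //.
    by apply: transitive_tournament_setU1 => // z; rewrite inE => /eqP->.
  rewrite -(ler_nat R) => h; apply: le_trans h _.
  rewrite oramsey_ub2; have : 0 <= m%:R :> R by rewrite ler0n.
  by lra.
rewrite oramsey_ub_rec //.
have ub0 k : 0 <= oramsey_ub R m k := oramsey_ub_ge0 R k m2.
apply: (@recursive_card_bound R m #|A| _ (oramsey_ub R m n.+1)) => //.
- exact: oramsey_ub_ge.
- exact: oramsey_ub_ratio.
move=> l K q K0 hD hE.
set D := oramsey_ub R m n.+2 in hD hE IH2;
  set E := oramsey_ub R m n.+1 in hE IH1.
(* The sampling argument wants natural degree bounds; truncation keeps them valid and only weakens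
   the conditions on [K] and [q]. *)
have trD : (Num.truncn D)%:R <= D by have /andP[] := truncn_itv (ub0 n.+2).
have trE : (Num.truncn E)%:R <= E by have /andP[] := truncn_itv (ub0 n.+1).
have le_trunc (x : R) (B : {set T}) : 0 <= x -> #|B|.+1%:R <= x -> (#|B| <=
  Num.truncn x)%N.
  move=> x0 Bx; have /andP[_] := truncn_itv x0; move/(le_lt_trans Bx).
  by rewrite ltr_nat ltnS => /ltnW.
have fout v : v \in A -> ramsey_free arc [set y in A | arc v y] m n.+2.
  by move=> vA; exact: ramsey_free_out.
apply: (@card_bound_of_local_bounds T arc A q K (Num.truncn D) (Num.truncn E))
  => //.
- exact: og.1.
- by move=> v vA; apply: le_trunc (ub0 _) _; exact: IH2 _ (fout v vA).
- move=> x y xA yA xy; apply: le_trunc (ub0 _) _.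
  (* A common out-neighbourhood is an out-neighbourhood of [y] inside that of [x], so the tournament
     size drops twice. *)
  have -> : [set z in A | arc x z & arc y z] = [set z in [set y in A | arc x y]
    | arc y z].
    by apply/setP=> z; rewrite !inE andbA.
  apply: IH1; apply: ramsey_free_out (fout x xA) => //.
  by rewrite inE yA.
- by move=> W WA iW; apply: ltnW; exact: fA.1.
- rewrite -(ler_nat R) !natrM; apply: le_trans hD; exact: ler_wpM2l.
- rewrite -(ler_nat R) natrX !natrM; apply: le_trans hE.
  by apply: ler_pM => //; [rewrite mulr_ge0 | exact: ler_wpM2l].
Qed.

Lemma subset_of_card (T : finType) (S : {set T}) k :
  (k <= #|S|)%N -> exists2 S' : {set T}, S' \subset S & #|S'| = k.
Proof.
rewrite -bin_gt0 -cards_draws => /card_gt0P[S']; rewrite inE => /andP[? /eqP ?].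
by exists S'.
Qed.

Theorem mainTheorem4 (R : realType) (m n : nat) (hm : (2 <= m)%N)
    (hn : (2 <= n)%N) :
  (oramsey m n)%:R <=
    2 ^+ (19 * n) * (m%:R ^+ (n - 1) / log2 (m%:R : R) ^+ (n - 2)) :> R.
Proof.
rewrite -/(oramsey_ub R m n) /oramsey; case: ex_minnP => k _ kmin.
rewrite leNgt; apply/negP=> hk.
have k0 : (0 < k)%N.
  by rewrite -(ltr_nat R); apply: le_lt_trans hk; exact: oramsey_ub_ge0.
(* By minimality some graph on [k.-1] vertices is Ramsey-free, and the successor in
   [ramsey_free_card] turns its size into [k]. *)
have : ~ ramsey_prop m n k.-1.
  by move=> /asboolP /kmin; rewrite leqNgt prednK // leqnn.
apply=> T arc cT og; apply: contrapT => no.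
have [] : ramsey_free arc [set: T] m n.
  split=> S _ hS; rewrite ltnNge; apply/negP=> /subset_of_card[S' /subsetP SS'
    cS'];
    apply: no; [left|right]; exists S'; split=> //.
    by move=> x y xS yS; apply: hS; exact: SS'.
  case: hS => tot tr; split=> [x y xS yS|x y z xS yS zS];
    [apply: tot|apply: tr]; exact: SS'.
move=> hI hL; move: hk; rewrite ltNge => /negP; apply.
case: n hn hI hL {no kmin} => // n _ hI hL.
have := @ramsey_free_card R m n T arc [set: T] hm og (conj hI hL).
by rewrite cardsT cT prednK.
Qed.
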